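(* Let $q_\varepsilon(t)$ be a space change of the trajectory $t\mapsto q(t)$, $t\in I$, $\tau(\varepsilon,t)$ a time change and $G(\varepsilon,t)$ a BH-function. Suppose that there is infinitesimal BH-invariance under space and time change for $(q_\varepsilon,\tau,G)$, and that $t\mapsto q(t)$ is a solution to the Lagrange equation. Then the following function is constant in $t\in I$: $$N(t)=\partial_{\dot q}L\bigl(t,q(t),\dot q(t)\bigr)\cdot\partial_\varepsilon q_\varepsilon(t)|_{\varepsilon=0}+L\bigl(t,q(t),\dot q(t)\bigr)\,\partial_\varepsilon\tau(\varepsilon,t)|_{\varepsilon=0}+\partial_\varepsilon G(\varepsilon,t)|_{\varepsilon=0}.$$
   Context: Let $n\ge1$ and let $L=L(t,q,\dot q)$ (the Lagrangian) be a smooth real-valued function on an open subset of $\mathbb{R}\times\mathbb{R}^n\times\mathbb{R}^n$. The symbols $\partial_qL,\partial_{\dot q}L$ denote the gradients with respect to the second and third arguments, viewed as vectors of $\mathbb{R}^n$; $x\cdot y$ is the Euclidean inner product; a dot over a function denotes the derivative in $t$. Let $t\mapsto q(t)\in\mathbb{R}^n$ be a smooth trajectory on an open interval $I$ such that $(t,q(t),\dot q(t))$ lies in the domain of $L$ for all $t\in I$. It is a solution to the Lagrange equation if $\frac{d}{dt}\partial_{\dot q}L(t,q(t),\dot q(t))-\partial_qL(t,q(t),\dot q(t))=0$ for all $t\in I$. All functions of $(\varepsilon,t)$ below are defined on an open neighbourhood of $\{0\}\times I$ in $\mathbb{R}\times I$ (i.e. for $t\in I$ and $\varepsilon$ close to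 $0$). A space change of $q$ is a smooth one-parameter family $(\varepsilon,t)\mapsto q_\varepsilon(t)\in\mathbb{R}^n$ with $q_0(t)=q(t)$ for all $t\in I$. A time change is a smooth real function $\tau(\varepsilon,t)$ with $\tau(0,t)=t$ for all $t\in I$. A BH-function is a smooth real function $G(\varepsilon,t)$. The Hamiltonian action is $A_{a,b}(q)=\int_a^bL(t,q(t),\dot q(t))\,dt$. Infinitesimal BH-invariance under space and time change for $(q_\varepsilon,\tau,G)$ means $$\frac{\partial}{\partial\varepsilon}\Bigl(A_{\tau(\varepsilon,a),\tau(\varepsilon,b)}(q_\varepsilon)+G(\varepsilon,b)-G(\varepsilon,a)\Bigr)\Big|_{\varepsilon=0}=0\quad\forall a,b\in I,$$ equivalently $$\frac{\partial}{\partial\varepsilon}\Bigl(L\bigl(\tau(\varepsilon,t),q_\varepsilon(\tau(\varepsilon,t)),\dot q_\varepsilon(\tau(\varepsilon,t))\bigr)\partial_t\tau(\varepsilon,t)+\partial_tG(\varepsilon,t)\Bigr)\Big|_{\varepsilon=0}=0\quad\forall t\in I,$$ where $\dot q_\varepsilon(\xi)$ is the derivative of $\xi\mapsto q_\varepsilon(\xi)$. *)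

(* Defs.v *)
From HB Require Import structures.
From mathcomp Require Import all_boot all_order all_algebra.
From mathcomp Require Import all_classical all_reals all_analysis.
Set Implicit Arguments.
Unset Strict Implicit.
Unset Printing Implicit Defensive.
Import Order.TTheory GRing.Theory Num.Theory.
Import numFieldNormedType.Exports.
Local Open Scope classical_set_scope.
Local Open Scope ring_scope.

(* Functions with an open domain are represented by total functions; only their
   values on the domain matter. In finite dimension, [Ck k U f] for an open [U]
   is the usual k-fold continuous differentiability of [f] on [U]. *)
Fixpoint Ck (R : realType) (V W : normedModType R) (k : nat)
    (U : set V) (f : V -> W) : Prop :=
  match k with
  | 0%N => forall x, U x -> {for x, continuous f}
  | k'.+1 => (forall x, U x -> differentiable f x) /\
             (forall v : V, Ck k' U ('D_v f))
  end.

Definition smooth_on (R : realType) (V W : normedModType R)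
    (U : set V) (f : V -> W) : Prop :=
  forall k, Ck k U f.

Definition smooth_Lagrangian (R : realType) (n : nat)
    (Omega : set (R * 'rV[R]_n * 'rV[R]_n))
    (L : R -> 'rV[R]_n -> 'rV[R]_n -> R) : Prop :=
  open Omega /\
  smooth_on Omega
    (fun z : R * 'rV[R]_n * 'rV[R]_n => L z.1.1 z.1.2 z.2).

(* [f eps t] is smooth on an open neighbourhood of {0} x I in R x I; the open
   neighbourhood may depend on [f]. *)
Definition smooth_family (R : realType) (W : normedModType R)
    (I : set R) (f : R -> R -> W) : Prop :=
  exists U : set (R * R),
    [/\ open U,
        (forall eps t, U (eps, t) -> I t),
        (forall t, I t -> U (0, t)) &
        smooth_on U (fun p : R * R => f p.1 p.2)].

Definition dotp (R : realType) (n : nat) (x y : 'rV[R]_n) : R :=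
  \sum_(i < n) x 0 i * y 0 i.

Definition gradient (R : realType) (n : nat) (f : 'rV[R]_n -> R)
    (x : 'rV[R]_n) : 'rV[R]_n :=
  \row_(i < n) 'D_(delta_mx 0 i) f x.

Definition grad_q (R : realType) (n : nat)
    (L : R -> 'rV[R]_n -> 'rV[R]_n -> R) (t : R) (x v : 'rV[R]_n) : 'rV[R]_n :=
  gradient (fun y => L t y v) x.

Definition grad_qdot (R : realType) (n : nat)
    (L : R -> 'rV[R]_n -> 'rV[R]_n -> R) (t : R) (x v : 'rV[R]_n) : 'rV[R]_n :=
  gradient (fun w => L t x w) v.

Definition trajectory (R : realType) (n : nat)
    (Omega : set (R * 'rV[R]_n * 'rV[R]_n)) (I : set R)
    (q : R -> 'rV[R]_n) : Prop :=
  smooth_on I q /\ (forall t, I t -> Omega (t, q t, derive1 q t)).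

Definition Lagrange_solution (R : realType) (n : nat)
    (L : R -> 'rV[R]_n -> 'rV[R]_n -> R) (I : set R)
    (q : R -> 'rV[R]_n) : Prop :=
  forall t, I t ->
    derive1 (fun s => grad_qdot L s (q s) (derive1 q s)) t
      - grad_q L t (q t) (derive1 q t) = 0.

Definition space_change (R : realType) (n : nat) (I : set R)
    (q : R -> 'rV[R]_n) (qe : R -> R -> 'rV[R]_n) : Prop :=
  smooth_family I qe /\ (forall t, I t -> qe 0 t = q t).

Definition time_change (R : realType) (I : set R) (tau : R -> R -> R) : Prop :=
  smooth_family I tau /\ (forall t, I t -> tau 0 t = t).

Definition BH_function (R : realType) (I : set R) (G : R -> R -> R) : Prop :=
  smooth_family I G.

(* The end points are not assumed to be ordered. *)
Definition oriented_integral (R : realType) (a b : R) (f : R -> R) : R :=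
  if a <= b then \int[lebesgue_measure]_(x in `[a, b]) f x
  else - \int[lebesgue_measure]_(x in `[b, a]) f x.

Definition action (R : realType) (n : nat)
    (L : R -> 'rV[R]_n -> 'rV[R]_n -> R) (a b : R) (q : R -> 'rV[R]_n) : R :=
  oriented_integral a b (fun t => L t (q t) (derive1 q t)).

Definition infinitesimal_BH_invariance (R : realType) (n : nat)
    (L : R -> 'rV[R]_n -> 'rV[R]_n -> R) (I : set R)
    (qe : R -> R -> 'rV[R]_n) (tau G : R -> R -> R) : Prop :=
  forall a b, I a -> I b ->
    derive1 (fun eps => action L (tau eps a) (tau eps b) (qe eps)
                        + G eps b - G eps a) 0 = 0.

Definition Noether_function (R : realType) (n : nat)
    (L : R -> 'rV[R]_n -> 'rV[R]_n -> R) (q : R -> 'rV[R]_n)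
    (qe : R -> R -> 'rV[R]_n) (tau G : R -> R -> R) (t : R) : R :=
  dotp (grad_qdot L t (q t) (derive1 q t)) (derive1 (fun eps => qe eps t) 0)
  + L t (q t) (derive1 q t) * derive1 (fun eps => tau eps t) 0
  + derive1 (fun eps => G eps t) 0.

(* Main.v *)
Require Import Defs.
From HB Require Import structures.
From mathcomp Require Import all_boot all_order all_algebra.
From mathcomp Require Import all_classical all_reals all_analysis.
From mathcomp Require Import ring lra.
Import Order.TTheory GRing.Theory Num.Theory.
Import numFieldNormedType.Exports.
Local Open Scope classical_set_scope.
Local Open Scope ring_scope.
(** Write l (e, t) for L along the varied curve q_e, so that the action is the
    integral of l (e, _) from tau (e, a) to tau (e, b). Its derivative at
    e = 0 has two sources. The moving end points contribute
    l (0, b) dtau (b) - l (0, a) dtau (a), where dtau is the derivative of tau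
    in e. The variation of the integrand contributes the integral over [a, b] of
      grad_q L . eta + grad_qdot L . eta',
    where eta is the derivative of q_e in e at e = 0; the exchange of mixed
    partial derivatives is what turns the variation of the velocity into the
    time derivative of eta. By the Lagrange equation this integrand is the
    derivative of the function w = grad_qdot L . eta, so its integral is
    w b - w a. Adding G, the derivative that the invariance makes zero is
    exactly N b - N a.

    No derivative is ever taken under an integral sign. The analytic core is
    [is_derive_increment]: if each P e is a primitive of l (e, _), and w is a
    primitive of the e-derivative of l at e = 0, then P e b - P e a has
    e-derivative w b - w a at 0. This is the mean value inequality applied to
    P e - P 0 - e w, whose derivative is uniformly o(e) on the compact [a, b].
    The lemma is used twice. With P e the integral of l (e, _), and w as above,
    it differentiates the action ([is_derive_oriented_integral], where
    [is_derive_moving_endpoint] adds the end point terms). With P e t a function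
    of two variables and w an integral, it shows that mixed partial derivatives
    commute ([mixed_derivative_swap]).

    Families (e, t) |-> f e t are treated as functions on R * R, whose
    directional derivatives along (1, 0) and (0, 1) are the partial derivatives
    in e and in t. Derivatives and gradients are total operators given by limits
    of difference quotients, so the ones that occur in the statement are
    equal to such directional derivatives without any regularity assumption. *)

Set Implicit Arguments.
Unset Strict Implicit.
Unset Printing Implicit Defensive.

(** * One-variable estimates *)

Lemma mean_value_bound (R : realType) (f df : R -> R) (J : set R) (M : R) :
  is_interval J ->
  (forall z, J z -> is_derive z 1 f (df z)) ->
  (forall z, J z -> `|df z| <= M) ->
  forall x y, J x -> J y -> `|f y - f x| <= M * `|y - x|.
Proof.
move=> itvJ dJ bJ.
have main x y : J x -> J y -> x <= y -> `|f y - f x| <= M * `|y - x|.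
  move=> Jx Jy xy.
  have sub z : z \in `[x, y] -> J z by rewrite in_itv/= => /itvJ; exact.
  have [||c /sub Jc ->] := @MVT_segment R f df x y xy.
  - by move=> z /subset_itv_oo_cc/sub/dJ.
  - by apply: derivable_within_continuous => z /sub/dJ[].
  - by rewrite normrM ler_wpM2r// bJ.
move=> x y Jx Jy; case: (leP x y) => [|/ltW] xy; first exact: main.
by rewrite distrC [X in _ * X]distrC main.
Qed.

(** The first-order expansion replaces the difference quotient by an estimate
    that makes sense at e = 0 too, and that survives being uniform in a
    parameter. *)
Lemma is_derive0P (R : realType) (f : R -> R) (D : R) :
  is_derive (0 : R) (1 : R) f D <->
  forall c, 0 < c -> \forall e \near (0 : R), `|f e - f 0 - e * D| <= c * `|e|.
Proof.
split=> [df c c0|H].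
- have : h^-1 *: (f (h *: 1 + 0) - f 0) @[h --> 0^'] --> D.
    by case: df => df <-; exact: df.
  move=> /cvgrPdist_le/(_ _ c0); rewrite near_withinE; apply: filterS => e He.
  have [->|e0] := eqVneq e 0; first by rewrite mul0r !subrr normr0 mulr0.
  have {He} := He e0; rewrite /= addr0 [e *: 1]mulr1.
  rewrite distrC => He.
  rewrite (_ : _ - e * D = (e^-1 *: (f e - f 0) - D) * e).
    by rewrite normrM ler_wpM2r.
  by rewrite mulrBl [_ *: _]mulrC divfK// (mulrC D).
- suff cv : h^-1 *: (f (h *: 1 + 0) - f 0) @[h --> 0^'] --> D.
    apply: DeriveDef; first by apply/cvg_ex; exists D.
    exact: cvg_lim cv.
  apply/cvgrPdist_le => c c0; rewrite near_withinE.
  move: (H _ c0); apply: filterS => e He e0.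
  rewrite /= addr0 [e *: 1]mulr1 distrC.
  rewrite -(ler_pM2r (_ : 0 < `|e|)) ?normr_gt0// -normrM mulrBl.
  by rewrite [_ *: _]mulrC divfK// (mulrC D).
Qed.

(** * Functions of the parameter and of time *)

(** The tube lemma: the segment {0} x [a, b] is compact, so a property that
    holds near each of its points holds on a whole strip around it. *)
Lemma near_segment (R : realType) (a b : R) (P : R * R -> Prop) :
  (forall t, t \in `[a, b] -> \forall p \near (0, t), P p) ->
  \forall e \near (0 : R), forall t, t \in `[a, b] -> P (e, t).
Proof.
move=> H.
have /compact_near_coveringP K := @segment_compact R a b.
apply: (K R (nbhs (0 : R)) (fun e t => P (e, t))) => t tab.
have [[A B] /= [A0 Bt] AB] := H _ tab.
by exists (B, A) => // -[x e] /= [Bx Ae]; apply: AB.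
Qed.

Section slices.
Context {R : realType} {W : normedModType R}.
Implicit Types (F : R * R -> W).

(* The difference quotients themselves agree, which gives the equality of the
   derivatives even where they do not exist. *)
Let slope1 F (e t : R) :
  (fun h : R => h^-1 *: (F (h *: (1, 0) + (e, t)) - F (e, t)))
  = (fun h : R => h^-1 *: (F (h *: 1 + e, t) - F (e, t))).
Proof.
apply/funext => h; congr (_ *: (F _ - _)).
by congr (_, _); rewrite /= scaler0 add0r.
Qed.

Let slope2 F (e t : R) :
  (fun h : R => h^-1 *: (F (h *: (0, 1) + (e, t)) - F (e, t)))
  = (fun h : R => h^-1 *: (F (e, h *: 1 + t) - F (e, t))).
Proof.
apply/funext => h; congr (_ *: (F _ - _)).
by congr (_, _); rewrite /= scaler0 add0r.
Qed.

Lemma derive_slice1 F (e t : R) :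
  'D_1 (fun x => F (x, t)) e = 'D_(1, 0) F (e, t).
Proof. by rewrite /derive slope1. Qed.

Lemma derive_slice2 F (e t : R) :
  'D_1 (fun x => F (e, x)) t = 'D_(0, 1) F (e, t).
Proof. by rewrite /derive slope2. Qed.

Lemma is_derive_slice1 F (e t : R) (D : W) :
  is_derive (e, t) (1, 0) F D <-> is_derive e 1 (fun x => F (x, t)) D.
Proof.
by split=> -[]; rewrite -?derive_slice1 /derivable ?slope1 => ? <-;
  apply: DeriveDef; rewrite -?derive_slice1 /derivable ?slope1.
Qed.

Lemma is_derive_slice2 F (e t : R) (D : W) :
  is_derive (e, t) (0, 1) F D <-> is_derive t 1 (fun x => F (e, x)) D.
Proof.
by split=> -[]; rewrite -?derive_slice2 /derivable ?slope2 => ? <-;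
  apply: DeriveDef; rewrite -?derive_slice2 /derivable ?slope2.
Qed.

Lemma continuous_slice2 F (e t : R) :
  {for (e, t), continuous F} -> {for t, continuous (fun x => F (e, x))}.
Proof.
move=> cF A /cF [[B C] /= [Be Ct] BC].
apply: filterS Ct => x Cx; apply: (BC (e, x)); split => //=.
exact: nbhs_singleton.
Qed.

End slices.

(** * Differentiation of increments of primitives *)

(** The mean value inequality bounds the remainder by the oscillation of m
    between (z, s) and (0, s), which is small near each (0, t); compactness
    makes this uniform in t. *)
Lemma uniform_expansion (R : realType) (l m : R * R -> R) (a b : R) :
  (forall t, t \in `[a, b] ->
    \forall p \near ((0, t) : R * R), is_derive (p : R * R) (1, 0) l (m p)) ->
  (forall t, t \in `[a, b] -> {for ((0, t) : R * R), continuous m}) ->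
  forall c, 0 < c -> \forall e \near (0 : R), forall t, t \in `[a, b] ->
    `|l (e, t) - l (0, t) - e * m (0, t)| <= c * `|e|.
Proof.
move=> dl cm c c0.
apply: (@near_segment R a b (fun p : R * R =>
  `|l p - l (0, p.2) - p.1 * m (0, p.2)| <= c * `|p.1|)) => t tab.
have [] : \forall p \near ((0, t) : R * R),
    is_derive (p : R * R) (1, 0) l (m p) /\ `|m (0, t) - m p| <= c / 2.
  near=> p; split; near: p; first exact: dl.
  by move: (cm _ tab) => /cvgrPdist_le; apply; rewrite divr_gt0.
move=> [A B] /= [/nbhs_ballP[r /= r0 rA] Bt] AB.
exists (ball 0 r, B); first by split => //; exact: nbhsx_ballx.
move=> [e s] /= [re Bs].
(* Both m (z, s) and m (0, s) are within c / 2 of m (0, t). *)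
have box (z : R) : `|z| < r -> is_derive (z, s) (1, 0) l (m (z, s)) /\
    `|m (0, t) - m (z, s)| <= c / 2.
  move=> zr; apply: (AB (z, s)); split => //; apply: rA.
  by rewrite /ball/= sub0r normrN.
have r00 : `|0 : R| < r by rewrite normr0.
have := @mean_value_bound R (fun z => l (z, s) - m (0, s) * z)
  (fun z => m (z, s) - m (0, s)) [set z | `|z| < r] c _ _ _ 0 e.
rewrite mulr0 !subr0 [_ - _ * e - _]addrAC (mulrC (m _)); apply => //.
- move=> x y /=; rewrite !ltr_norml => /andP[rx _] /andP[_ yr] z /andP[xz zy].
  by rewrite /= ltr_norml (lt_le_trans rx xz) (le_lt_trans zy yr).
- move=> z /box[/is_derive_slice1 dz _].
  by apply: is_derive_eq; rewrite [_ *: 1]mulr1.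
- move=> z /box[_ zc]; have [_ sc] := box 0 r00.
  by move: zc sc; rewrite !ler_norml => /andP[? ?] /andP[? ?]; lra.
- by move: re; rewrite /ball/= sub0r normrN.
Unshelve. all: by end_near. Qed.

(** The function P e - P 0 - e w has derivative
    l (e, t) - l (0, t) - e m (0, t), which is o(e) uniformly on [a, b] by
    [uniform_expansion]; by the mean value inequality so is its increment over
    [a, b]. With w an integral, this is differentiation under the integral
    sign. *)
Lemma is_derive_increment (R : realType) (P : R -> R -> R) (l m : R * R -> R)
    (w : R -> R) (a b : R) :
  a <= b ->
  (\forall e \near (0 : R), forall t, t \in `[a, b] ->
    is_derive t 1 (P e) (l (e, t))) ->
  (forall t, t \in `[a, b] ->
    \forall p \near ((0, t) : R * R), is_derive (p : R * R) (1, 0) l (m p)) ->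
  (forall t, t \in `[a, b] -> {for ((0, t) : R * R), continuous m}) ->
  (forall t, t \in `[a, b] -> is_derive t 1 w (m (0, t))) ->
  is_derive (0 : R) (1 : R) (fun e => P e b - P e a) (w b - w a).
Proof.
move=> ab dP dl cm dw; apply/is_derive0P => c c0.
have ab1 : 0 < b - a + 1 by rewrite ltr_wpDl// subr_ge0.
have dP0 := nbhs_singleton dP.
(* The 1 keeps the divisor positive when a = b. *)
have Eexp := uniform_expansion dl cm (divr_gt0 c0 ab1).
near=> e.
have dPe : forall t, t \in `[a, b] -> is_derive t 1 (P e) (l (e, t)).
  by near: e.
have le : forall t, t \in `[a, b] ->
    `|l (e, t) - l (0, t) - e * m (0, t)| <= c / (b - a + 1) * `|e|.
  by near: e.
have := @mean_value_bound R (fun t => P e t - P 0 t - e * w t)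
  (fun t => l (e, t) - l (0, t) - e * m (0, t)) `[a, b]
  (c / (b - a + 1) * `|e|) _ _ _ a b.
rewrite (_ : _ - _ - e * w b - _ = P e b - P e a - (P 0 b - P 0 a) -
  e * (w b - w a)); last by ring.
move=> H; apply: le_trans (H _ _ _ _ _) _.
- exact: interval_is_interval.
- move=> t tab; have ? := dPe _ tab; have ? := dP0 _ tab; have ? := dw _ tab.
  exact: is_derive_eq.
- by move=> t /le.
- by rewrite /= in_itv/= lexx.
- by rewrite /= in_itv/= lexx ab.
- rewrite (@ger0_norm _ (b - a)) ?subr_ge0// mulrAC ler_wpM2r// -mulrA.
  rewrite ler_piMr ?(ltW c0)//.
  by rewrite mulrC ler_pdivrMr// mul1r lerDl.
Unshelve. all: by end_near. Qed.

(** * The integral as a primitive *)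

Section oriented_primitive.
Context {R : realType} (f : R -> R) (u v : R).
Hypothesis cf : forall x, x \in `[u, v] -> {for x, continuous f}.

Let integrable_segment x : x <= v ->
  lebesgue_measure.-integrable `[u, x] (EFin \o f).
Proof.
move=> xv; apply: continuous_compact_integrable; first exact: segment_compact.
apply: continuous_in_subspaceT => y; rewrite inE /= => yux; apply: cf.
by move: yux; rewrite !in_itv/= => /andP[-> /le_trans->].
Qed.

Lemma is_derive_primitive x : x \in `]u, v[ ->
  is_derive x 1 (fun y => parameterized_integral lebesgue_measure u y f) (f x).
Proof.
rewrite in_itv/= => /andP[ux xv].
have [|||] := @continuous_FTC1 R f (BLeft u) x v xv.
- exact: integrable_segment.
- by rewrite lte_fin.
- by apply: cf; rewrite in_itv/= !ltW.
- by move=> dP <-; rewrite derive1E; exact: DeriveDef.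
Qed.

Lemma oriented_integral_primitive x y : x \in `]u, v[ -> y \in `]u, v[ ->
  oriented_integral x y f =
    parameterized_integral lebesgue_measure u y f -
    parameterized_integral lebesgue_measure u x f.
Proof.
have main s t : u < s -> t < v -> s <= t ->
    \int[lebesgue_measure]_(z in `[s, t]) f z =
    parameterized_integral lebesgue_measure u t f -
    parameterized_integral lebesgue_measure u s f.
  move=> us tv st; rewrite /parameterized_integral.
  rewrite Rintegral_itvB//; last 2 first.
  - exact/integrable_segment/ltW.
  - by rewrite bnd_simp ltW.
  rewrite Rintegral_itv_obnd_cbnd//.
  apply: integrableS (integrable_segment (ltW tv)) => //.
  by apply: subset_itvr; rewrite bnd_simp ltW.
rewrite !in_itv/= => /andP[ux xv] /andP[uy yv]; rewrite /oriented_integral.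
by case: leP => [|/ltW] xy; rewrite main// opprB.
Qed.

End oriented_primitive.

(** * Mixed partial derivatives *)

(** Here phi and l are the partial derivatives of f in e and in t, and m that of
    l in e. As f (e, _) is a primitive of l (e, _), [is_derive_increment] says
    that phi (0, t) - phi (0, a) is the increment of a primitive w of m (0, _):
    so phi (0, _) equals w up to a constant, and is differentiable. *)
Lemma mixed_derivative_swap (R : realType) (f phi l m : R * R -> R) (t0 : R) :
  (\forall p \near ((0, t0) : R * R),
    [/\ is_derive (p : R * R) (1, 0) f (phi p),
        is_derive (p : R * R) (0, 1) f (l p),
        is_derive (p : R * R) (1, 0) l (m p) & {for p, continuous m}]) ->
  is_derive t0 1 (fun t => phi (0, t)) (m (0, t0)).
Proof.
pose Q (p : R * R) := [/\ is_derive p (1, 0) f (phi p),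
        is_derive (p : R * R) (0, 1) f (l p),
        is_derive (p : R * R) (1, 0) l (m p) & {for p, continuous m}].
move=> [[A B] /= [A0 /nbhs_ballP[r /= r0 rB]] AB].
have box (t : R) : t \in `[t0 - r / 2, t0 + r / 2] -> B t.
  rewrite in_itv/= => /andP[ht th]; apply: rB.
  by rewrite /ball/= ltr_norml; apply/andP; split; lra.
(* Three nested intervals around t0, with radii r / 4, r / 2 and r: w starts at
   the end u of the middle one, and is only known to be differentiable in its
   interior, which contains the point a from which increments are taken. *)
pose u := t0 - r / 2; pose v := t0 + r / 2.
have Duv (t : R) : t \in `[u, v] -> Q (0, t).
  move=> /box Bt; apply: (AB (0, t)); split => //=; exact: nbhs_singleton.
pose w t := parameterized_integral lebesgue_measure u t (fun s => m (0, s)).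
have dw (t : R) : t \in `]u, v[ -> is_derive t 1 w (m (0, t)).
  move=> tuv; apply: is_derive_primitive tuv => x /Duv[_ _ _ cm].
  exact: continuous_slice2.
pose a := t0 - r / 4.
have phiE (t : R) : t \in `]a, t0 + r / 4[ ->
    phi (0, t) = w t + (phi (0, a) - w a).
  rewrite in_itv/= => /andP[a_t tr].
  have sub (s : R) : s \in `[a, t] -> s \in `]u, v[.
    rewrite !in_itv/= /u /v /a => /andP[? ?].
    by apply/andP; split; lra.
  have subB (s : R) : s \in `[a, t] -> nbhs s B.
    move=> /sub; rewrite in_itv/= /u /v => /andP[? ?].
    apply: filterS rB _; apply: open_nbhs_nbhs; split; first exact: ball_open.
    by rewrite /ball/= ltr_norml; apply/andP; split; lra.
  have near_s (s : R) : s \in `[a, t] -> \forall p \near ((0, s) : R * R), Q p.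
    by move=> /subB Bs; exists (A, B).
  have dinc : is_derive (0 : R) (1 : R) (fun e => f (e, t) - f (e, a))
      (w t - w a).
    have dseg : \forall e \near (0 : R), forall s, s \in `[a, t] ->
        is_derive s 1 (fun x => f (e, x)) (l (e, s)).
      apply: (@near_segment R a t
        (fun p => is_derive p.2 1 (fun x => f (p.1, x)) (l p))) => s /near_s.
      by apply: filterS => -[e x] [_ /is_derive_slice2].
    have dl (s : R) : s \in `[a, t] ->
        \forall p \near ((0, s) : R * R), is_derive (p : R * R) (1, 0) l (m p).
      by move=> /near_s; apply: filterS => p [].
    have cm (s : R) : s \in `[a, t] -> {for ((0, s) : R * R), continuous m}.
      by move=> /near_s/nbhs_singleton[].
    have dws (s : R) : s \in `[a, t] -> is_derive s 1 w (m (0, s)).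
      by move=> /sub/dw.
    exact: (is_derive_increment (P := fun e s => f (e, s)) (ltW a_t)
      dseg dl cm dws).
  have ain : a \in `[a, t] by rewrite in_itv/= lexx ltW.
  have tin : t \in `[a, t] by rewrite in_itv/= lexx ltW.
  have [/is_derive_slice1 da _ _ _] := nbhs_singleton (near_s _ ain).
  have [/is_derive_slice1 dt _ _ _] := nbhs_singleton (near_s _ tin).
  have E : phi (0, t) - phi (0, a) = w t - w a.
    rewrite -(@derive_val _ _ _ _ _ _ _ dinc).
    exact/esym/(@derive_val _ _ _ _ _ _ _ (is_deriveB dt da)).
  by rewrite addrCA -E addrC subrK.
have t0in : t0 \in `]a, t0 + r / 4[.
  by rewrite in_itv/= /a; apply/andP; split; lra.
apply: (@near_eq_is_derive _ _ _ (fun t => w t + (phi (0, a) - w a))).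
  near=> t; apply/esym/phiE; near: t; exact: near_in_itvoo.
have dw0 : is_derive t0 1 w (m (0, t0)).
  by apply: dw; rewrite in_itv/= /u /v; apply/andP; split; lra.
by apply: is_derive_eq; rewrite addr0.
Unshelve. all: by end_near. Qed.

(** * Differentiation of an integral with moving end points *)

(** Although P e changes with e, its slope near gamma 0 stays close to
    l (0, gamma 0), so moving the end point from gamma 0 to gamma e changes P e
    by l (0, gamma 0) (gamma e - gamma 0) up to o(e). *)
Lemma is_derive_moving_endpoint (R : realType) (P : R -> R -> R)
    (l : R * R -> R) (gamma : R -> R) (dgamma : R) :
  (\forall p \near ((0, gamma 0) : R * R),
    is_derive (p.2 : R) 1 (P p.1) (l p)) ->
  {for ((0, gamma 0) : R * R), continuous l} ->
  is_derive (0 : R) (1 : R) gamma dgamma ->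
  is_derive (0 : R) (1 : R) (fun e => P e (gamma e) - P e (gamma 0))
    (l (0, gamma 0) * dgamma).
Proof.
move=> dP cl dg; set c := gamma 0; set l0 := l (0, c).
suff d0 : is_derive (0 : R) (1 : R)
    (fun e => P e (gamma e) - P e c - l0 * (gamma e - c)) 0.
  have -> : (fun e => P e (gamma e) - P e c) = fun e =>
     (P e (gamma e) - P e c - l0 * (gamma e - c)) + l0 * (gamma e - c).
    by apply/funext => e; rewrite subrK.
  by apply: is_derive_eq; rewrite add0r subr0 [_ *: _]/=.
apply/is_derive0P => k k0.
have M0 : 0 < `|dgamma| + 1 by rewrite ltr_wpDl.
pose k' := k / (`|dgamma| + 1).
have [] : \forall p \near ((0, c) : R * R),
    is_derive (p.2 : R) 1 (P p.1) (l p) /\ `|l0 - l p| <= k'.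
  near=> p; split; near: p; first exact: dP.
  by move: cl => /cvgrPdist_le; apply; rewrite divr_gt0.
move=> [A B] /= [A0 /nbhs_ballP[r /= r0 rB]] AB.
near=> e.
have Ae : A e by near: e.
(* gamma is differentiable at 0, hence Lipschitz there. *)
have ge : `|gamma e - c| <= (`|dgamma| + 1) * `|e|.
  have : `|gamma e - c - e * dgamma| <= 1 * `|e|.
    by near: e; move: dg => /is_derive0P; apply.
  move=> h; rewrite -(subrK (e * dgamma) (gamma e - c)).
  by rewrite (le_trans (ler_normD _ _))// mulrDl addrC lerD// normrM mulrC.
have gr : `|gamma e - c| < r.
  apply: le_lt_trans ge _; rewrite mulrC -ltr_pdivlMr//.
  near: e; exists (r / (`|dgamma| + 1)) => [|z]; first exact: divr_gt0.
  by rewrite /= sub0r normrN.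
have := @mean_value_bound R (fun t => P e t - l0 * t) (fun t => l (e, t) - l0)
  [set t | `|t - c| < r] k' _ _ _ c (gamma e).
rewrite (_ : P 0 _ - _ = 0); last by rewrite !subrr.
move=> H; apply: le_trans (_ : k' * `|gamma e - c| <= _); last first.
  have k'0 : 0 <= k' by rewrite divr_ge0// ltW.
  by rewrite (le_trans (ler_wpM2l k'0 ge))// mulrA divfK ?gt_eqF.
rewrite [gamma 0 - c]subrr !mulr0 !subr0.
rewrite (_ : _ - _ - _ = P e (gamma e) - l0 * gamma e - (P e c - l0 * c)).
  2: by rewrite mulrBr; ring.
have boxP (t : R) : `|t - c| < r -> is_derive t 1 (P e) (l (e, t)) /\
    `|l0 - l (e, t)| <= k'.
  move=> tr; apply: (AB (e, t)); split => //; apply: rB.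
  by rewrite /ball/= distrC.
apply: H => //=.
- move=> x y /=; rewrite !ltr_norml => /andP[rx _] /andP[_ yr] z /andP[xz zy].
  by rewrite /= ltr_norml; apply/andP; split; lra.
- move=> t /boxP[dt _]; by apply: is_derive_eq; rewrite [_ *: 1]mulr1.
- by move=> t /boxP[_]; rewrite distrC.
- by rewrite subrr normr0.
Unshelve. all: by end_near. Qed.

(** Leibniz rule, with the integral over [alpha 0, beta 0] of the e-derivative m
    expressed by a primitive w of m (0, _). With P e the primitive of l (e, _)
    based at u, the integral is P e (beta e) - P e (alpha e), which splits into
    the increment of P e between the fixed end points and two end point
    corrections. The enclosing segment [u, v] leaves room for the end points
    to move. *)
Lemma is_derive_oriented_integral (R : realType) (l m : R * R -> R)
    (w alpha beta : R -> R) (u v dalpha dbeta : R) :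
  alpha 0 <= beta 0 -> u < alpha 0 -> beta 0 < v ->
  (forall t, t \in `[u, v] -> \forall p \near ((0, t) : R * R),
    is_derive (p : R * R) (1, 0) l (m p) /\ {for p, continuous l}) ->
  (forall t, t \in `[u, v] -> {for ((0, t) : R * R), continuous m}) ->
  (forall t, t \in `[alpha 0, beta 0] -> is_derive t 1 w (m (0, t))) ->
  is_derive (0 : R) (1 : R) alpha dalpha ->
  is_derive (0 : R) (1 : R) beta dbeta ->
  is_derive (0 : R) (1 : R)
    (fun e => oriented_integral (alpha e) (beta e) (fun t => l (e, t)))
    (w (beta 0) - w (alpha 0)
      + l (0, beta 0) * dbeta - l (0, alpha 0) * dalpha).
Proof.
move=> ab ua bv dl cm dw da db.
set a := alpha 0 in ab ua dw *; set b := beta 0 in ab bv dw *.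
pose P e t := parameterized_integral lebesgue_measure u t (fun s => l (e, s)).
have cl : \forall e \near (0 : R), forall t, t \in `[u, v] ->
    {for t, continuous (fun s => l (e, s))}.
  apply: (@near_segment R u v
    (fun p => {for p.2, continuous (fun s => l (p.1, s))})) => t /dl.
  by apply: filterS => -[e s] [_ /continuous_slice2].
have dP : \forall e \near (0 : R), forall t, t \in `]u, v[ ->
    is_derive t 1 (P e) (l (e, t)).
  by apply: filterS cl => e ce t; exact: is_derive_primitive.
have dPseg : \forall e \near (0 : R), forall t, t \in `[a, b] ->
    is_derive t 1 (P e) (l (e, t)).
  apply: filterS dP => e dPe t; rewrite in_itv/= => /andP[ta tb].
  by apply: dPe; rewrite in_itv/= (lt_le_trans ua ta) (le_lt_trans tb bv).
have sub t : t \in `[a, b] -> t \in `[u, v].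
  rewrite !in_itv/= => /andP[ta tb].
  by rewrite (le_trans (ltW ua) ta) (le_trans tb (ltW bv)).
have dl' (t : R) : t \in `[a, b] -> \forall p \near ((0, t) : R * R),
    is_derive (p : R * R) (1, 0) l (m p).
  by move=> /sub/dl; apply: filterS => p [].
have cm' (t : R) : t \in `[a, b] -> {for ((0, t) : R * R), continuous m}.
  by move=> /sub/cm.
have dincr := is_derive_increment ab dPseg dl' cm' dw.
have auv : a \in `]u, v[ by rewrite in_itv/= ua (le_lt_trans ab bv).
have buv : b \in `]u, v[ by rewrite in_itv/= bv (lt_le_trans ua ab).
have near_c (c : R) : c \in `]u, v[ ->
    \forall p \near ((0, c) : R * R), is_derive (p.2 : R) 1 (P p.1) (l p).
  move=> /near_in_itvoo cuv.
  exists ([set e | forall t, t \in `]u, v[ -> is_derive t 1 (P e) (l (e, t))],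
    [set` `]u, v[]) => //.
  by move=> [e t] /= [] He /He.
have cl_c (c : R) : c \in `]u, v[ -> {for ((0, c) : R * R), continuous l}.
  move=> /subset_itv_oo_cc/dl/nbhs_singleton[_]; exact.
have dA := is_derive_moving_endpoint (near_c _ auv) (cl_c _ auv) da.
have dB := is_derive_moving_endpoint (near_c _ buv) (cl_c _ buv) db.
have near_in (g : R -> R) (dg : R) : is_derive (0 : R) (1 : R) g dg ->
    g 0 \in `]u, v[ -> \forall e \near (0 : R), g e \in `]u, v[.
  move=> [/derivable1_diffP/differentiable_continuous cg _] /near_in_itvoo.
  exact: cg.
apply: (@near_eq_is_derive _ _ _ (fun e => (P e b - P e a)
  + (P e (beta e) - P e b) - (P e (alpha e) - P e a))).
  near=> e.
  have ae : alpha e \in `]u, v[ by near: e; exact: near_in da _.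
  have be : beta e \in `]u, v[ by near: e; exact: near_in db _.
  rewrite (@oriented_integral_primitive _ _ u v)//; last by near: e.
  by rewrite /P; ring.
Unshelve. all: by end_near. Qed.

(** * Vector-valued and smooth functions *)

Lemma is_derive_coord (R : realType) (V : normedModType R) (n : nat)
    (M : V -> 'rV[R]_n) (t v : V) (D : 'rV[R]_n) (j : 'I_n) :
  is_derive t v M D -> is_derive t v (fun x => M x 0 j) (D 0 j).
Proof.
move=> [dM <-]; apply: DeriveDef; first exact: (derivable_mxP M t v).1.
by rewrite derive_mx// !mxE.
Qed.

Lemma smooth_on_derive (R : realType) (V W : normedModType R) (U : set V)
    (f : V -> W) (v : V) :
  smooth_on U f -> smooth_on U ('D_v f).
Proof. by move=> fU k; have [_] := fU k.+1; apply. Qed.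

Lemma smooth_on_differentiable (R : realType) (V W : normedModType R)
    (U : set V) (f : V -> W) (x : V) :
  smooth_on U f -> U x -> differentiable f x.
Proof. by move=> fU; have [+ _] := fU 1; apply. Qed.

Lemma smooth_on_is_derive (R : realType) (V W : normedModType R)
    (U : set V) (f : V -> W) (x v : V) :
  smooth_on U f -> U x -> is_derive x v f ('D_v f x).
Proof.
by move=> fU Ux; apply/derivableP/diff_derivable/(smooth_on_differentiable fU).
Qed.

Lemma smooth_on_continuous (R : realType) (V W : normedModType R)
    (U : set V) (f : V -> W) (x : V) :
  smooth_on U f -> U x -> {for x, continuous f}.
Proof. by move=> fU; exact: fU 0 x. Qed.

Lemma is_derive_row (R : realType) (V : normedModType R) (n : nat)
    (M : V -> 'rV[R]_n) (t v : V) (D : 'rV[R]_n) :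
  (forall j, is_derive t v (fun x => M x 0 j) (D 0 j)) -> is_derive t v M D.
Proof.
move=> dM; have dMt : derivable M t v.
  by apply/derivable_mxP => i j; rewrite ord1; case: (dM j).
apply: DeriveDef => //; rewrite derive_mx//; apply/rowP => j; rewrite mxE.
exact: (@derive_val _ _ _ _ _ _ _ (dM j)).
Qed.

Lemma is_derive_dotp (R : realType) (n : nat) (x y : R -> 'rV[R]_n)
    (t : R) (dx dy : 'rV[R]_n) :
  is_derive t 1 x dx -> is_derive t 1 y dy ->
  is_derive t 1 (fun s => dotp (x s) (y s)) (dotp dx (y t) + dotp (x t) dy).
Proof.
move=> dX dY.
rewrite /dotp -big_split/=.
have -> : (fun s => \sum_(i < n) x s 0 i * y s 0 i) =
    \sum_(i < n) (fun s => x s 0 i * y s 0 i).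
  by apply/funext => s; rewrite fct_sumE.
apply: is_derive_sum => i.
have := is_derive_coord i dX.
have := is_derive_coord i dY.
move=> dyi dxi; apply: is_derive_eq.
by rewrite addrC [y t 0 i *: _]mulrC.
Qed.

(** * Derivatives of the Lagrangian *)

Section Lagrangian.
Context {R : realType} {n : nat}.
Variable L : R -> 'rV[R]_n -> 'rV[R]_n -> R.
Let Lz (z : R * 'rV[R]_n * 'rV[R]_n) := L z.1.1 z.1.2 z.2.

Lemma grad_qE (z : R * 'rV[R]_n * 'rV[R]_n) i :
  grad_q L z.1.1 z.1.2 z.2 0 i = 'D_(0, delta_mx 0 i, 0) Lz z.
Proof.
case: z => -[t x] v; rewrite mxE /derive.
have -> : (fun h : R => h^-1 *: (Lz (h *: (0, delta_mx 0 i, 0) + (t, x, v)) -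
    Lz (t, x, v))) =
    (fun h => h^-1 *: (L t (h *: delta_mx 0 i + x) v - L t x v)).
  by apply/funext => h; rewrite /Lz/= !scaler0 !add0r.
by [].
Qed.

Lemma grad_qdotE (z : R * 'rV[R]_n * 'rV[R]_n) i :
  grad_qdot L z.1.1 z.1.2 z.2 0 i = 'D_(0, 0, delta_mx 0 i) Lz z.
Proof.
case: z => -[t x] v; rewrite mxE /derive.
have -> : (fun h : R => h^-1 *: (Lz (h *: (0, 0, delta_mx 0 i) + (t, x, v)) -
    Lz (t, x, v))) =
    (fun h => h^-1 *: (L t x (h *: delta_mx 0 i + v) - L t x v)).
  by apply/funext => h; rewrite /Lz/= !scaler0 !add0r.
by [].
Qed.

Lemma derive_Lagrangian (z : R * 'rV[R]_n * 'rV[R]_n) (x v : 'rV[R]_n) :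
  differentiable Lz z ->
  'D_(0, x, v) Lz z =
    dotp (grad_q L z.1.1 z.1.2 z.2) x + dotp (grad_qdot L z.1.1 z.1.2 z.2) v.
Proof.
move=> dL; rewrite deriveE//.
(* The canonical basis spans the position and the velocity components. *)
pose emb1 (y : 'rV[R]_n) : R * 'rV[R]_n * 'rV[R]_n := (0, y, 0).
pose emb2 (y : 'rV[R]_n) : R * 'rV[R]_n * 'rV[R]_n := (0, 0, y).
have sum_emb1 y : emb1 y = \sum_(i < n) y 0 i *: emb1 (delta_mx 0 i).
  rewrite {1}(row_sum_delta y) (@big_morph _ _ emb1 0 +%R 0 +%R)//; last first.
    by move=> y1 y2; congr (_, _, _); rewrite addr0.
  by apply: eq_bigr => i _; congr (_, _, _); rewrite scaler0.
have sum_emb2 y : emb2 y = \sum_(i < n) y 0 i *: emb2 (delta_mx 0 i).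
  rewrite {1}(row_sum_delta y) (@big_morph _ _ emb2 0 +%R 0 +%R)//; last first.
    by move=> y1 y2; congr (_, _, _); rewrite addr0.
  by apply: eq_bigr => i _; congr (_, _, _); rewrite scaler0.
have -> : (0, x, v) = emb1 x + emb2 v by congr (_, _, _); rewrite ?addr0 ?add0r.
rewrite linearD sum_emb1 sum_emb2 !linear_sum /dotp.
congr (_ + _); apply: eq_bigr => i _.
  by rewrite grad_qE deriveE// linearZ mulrC.
by rewrite grad_qdotE deriveE// linearZ mulrC.
Qed.

End Lagrangian.

(** * The Lagrangian along a family of curves *)

Section phase.
Context {R : realType} {n : nat}.
Variables (L : R -> 'rV[R]_n -> 'rV[R]_n -> R).
Variables (Omega : set (R * 'rV[R]_n * 'rV[R]_n)) (U : set (R * R)).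
Variable Q : R * R -> 'rV[R]_n.
Let Lz (z : R * 'rV[R]_n * 'rV[R]_n) := L z.1.1 z.1.2 z.2.
Hypotheses (openO : open Omega) (smoothL : smooth_on Omega Lz).
Hypotheses (openU : open U) (smoothQ : smooth_on U Q).

Definition phase (p : R * R) : R * 'rV[R]_n * 'rV[R]_n :=
  (p.2, Q p, 'D_(0, 1) Q p).

Let differentiable_snd (p : R * R) : differentiable (snd : R * R -> R) p.
Proof. by apply: linear_differentiable => x; exact: cvg_snd. Qed.

Let differentiable_Q p : U p -> differentiable Q p.
Proof. exact: smooth_on_differentiable. Qed.

Let differentiable_dQ p (v : R * R) : U p -> differentiable ('D_v Q) p.
Proof. exact/smooth_on_differentiable/smooth_on_derive. Qed.

Lemma differentiable_phase p : U p -> differentiable phase p.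
Proof.
move=> Up; apply: differentiable_pair; last exact: differentiable_dQ.
by apply: differentiable_pair => //; exact: differentiable_Q.
Qed.

Lemma diff_phase p v : U p ->
  'd phase p v = (v.2, 'D_v Q p, 'D_v ('D_(0, 1) Q) p).
Proof.
move=> Up; have dQ := differentiable_Q Up.
have dQ' := differentiable_dQ (0, 1) Up.
rewrite /phase diff_pair//; last exact: differentiable_pair.
rewrite diff_pair// !deriveE//; congr (_, _, _).
by rewrite diff_lin// => x; exact: cvg_snd.
Qed.

(** The e-derivative of L along [phase], which does not involve the
    time derivative of L because the clock p.2 is independent of e. *)
Definition variation_L (p : R * R) : R :=
  dotp (grad_q L p.2 (Q p) ('D_(0, 1) Q p)) ('D_(1, 0) Q p) +
  dotp (grad_qdot L p.2 (Q p) ('D_(0, 1) Q p)) ('D_(1, 0) ('D_(0, 1) Q) p).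

Lemma is_derive_Lphase (p : R * R) : U p -> Omega (phase p) ->
  is_derive p (1, 0) (Lz \o phase) (variation_L p).
Proof.
move=> Up Op; have dL := smooth_on_differentiable smoothL Op.
have dph := differentiable_phase Up.
have dc : differentiable (Lz \o phase) p by exact: differentiable_comp.
apply: DeriveDef; first exact: diff_derivable.
rewrite deriveE// diff_comp// [LHS]/= diff_phase//= -deriveE//.
exact: derive_Lagrangian.
Qed.

Lemma continuous_variation_L (p : R * R) : U p -> Omega (phase p) ->
  {for p, continuous variation_L}.
Proof.
move=> Up Op.
have cph : {for p, continuous phase}.
  exact/differentiable_continuous/differentiable_phase.
have sQ' v := smooth_on_derive v smoothQ.
have sQ'' v := smooth_on_derive v (sQ' ((0, 1) : R * R)).
have cdot (g y : R * R -> 'rV[R]_n) (W : 'I_n -> R * 'rV[R]_n * 'rV[R]_n) :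
    (forall i, (fun p => g p 0 i) = ('D_(W i) Lz) \o phase) ->
    {for p, continuous y} -> {for p, continuous (fun p => dotp (g p) (y p))}.
  move=> gE cy; rewrite /dotp /prop_for /continuous_at.
  apply: (cvg_big (@add_continuous _)) => i _; apply: cvgM.
    rewrite (_ : g p 0 i = (('D_(W i) Lz) \o phase) p); last by rewrite -gE.
    rewrite gE; apply: (@continuous_comp _ _ _ phase ('D_(W i) Lz)) => //.
    exact: smooth_on_continuous (smooth_on_derive (W i) smoothL) Op.
  exact: (@continuous_comp _ _ _ y (fun M : 'rV[R]_n => M 0 i) _ cy
    (@coord_continuous _ _ _ _ _ _)).
apply: (@continuousD _ _ _ (fun p =>
  dotp (grad_q L p.2 (Q p) ('D_(0, 1) Q p)) ('D_(1, 0) Q p))).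
  apply: (cdot _ _ (fun i => (0, delta_mx 0 i, 0))).
    by move=> i; apply/funext => x; rewrite -[RHS]grad_qE.
  exact: smooth_on_continuous (sQ' (1, 0)) Up.
apply: (cdot _ _ (fun i => (0, 0, delta_mx 0 i))).
  by move=> i; apply/funext => x; rewrite -[RHS]grad_qdotE.
exact: smooth_on_continuous (sQ'' (1, 0)) Up.
Qed.

Lemma near_domain (p : R * R) : U p -> Omega (phase p) ->
  \forall x \near p, U x /\ Omega (phase x).
Proof.
move=> Up Op; near=> x; split; near: x; first exact: open_nbhs_nbhs.
apply: (differentiable_continuous (differentiable_phase Up)).
exact: open_nbhs_nbhs.
Unshelve. all: by end_near. Qed.

(** The time derivative of the variation of the position is the variation of the
    velocity. *)
Lemma is_derive_velocity_variation (t : R) : U (0, t) ->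
  is_derive t 1 (fun s => 'D_(1, 0) Q (0, s)) ('D_(1, 0) ('D_(0, 1) Q) (0, t)).
Proof.
move=> Ut; apply: is_derive_row => j.
have sQ' v := smooth_on_derive v smoothQ.
have sQ'' v := smooth_on_derive v (sQ' ((0, 1) : R * R)).
apply: (@mixed_derivative_swap R (fun p => Q p 0 j)
  (fun p => 'D_(1, 0) Q p 0 j) (fun p => 'D_(0, 1) Q p 0 j)
  (fun p => 'D_(1, 0) ('D_(0, 1) Q) p 0 j)).
have : nbhs (0, t) U by exact: open_nbhs_nbhs.
apply: filterS => p Up; split.
- exact/is_derive_coord/(smooth_on_is_derive _ smoothQ Up).
- exact/is_derive_coord/(smooth_on_is_derive _ smoothQ Up).
- exact/is_derive_coord/(smooth_on_is_derive _ (sQ' ((0, 1) : R * R)) Up).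
- have c := smooth_on_continuous (sQ'' (1, 0)) Up.
  exact: (@continuous_comp _ _ _ _ (fun M : 'rV[R]_n => M 0 j) _ c
    (@coord_continuous _ _ _ _ _ _)).
Qed.

Lemma derivable_momentum (t : R) : U (0, t) -> Omega (phase (0, t)) ->
  derivable (fun s => grad_qdot L s (Q (0, s)) ('D_(0, 1) Q (0, s))) t 1.
Proof.
move=> Ut Ot; apply/derivable_mxP => i j; rewrite ord1.
have -> : (fun s => grad_qdot L s (Q (0, s)) ('D_(0, 1) Q (0, s)) 0 j) =
    fun s => ('D_(0, 0, delta_mx 0 j) Lz \o phase) (0, s).
  by apply/funext => s; rewrite /= -[RHS]grad_qdotE.
have dc : differentiable ('D_(0, 0, delta_mx 0 j) Lz \o phase) (0, t).
  apply: differentiable_comp; first exact: differentiable_phase.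
  exact: smooth_on_differentiable (smooth_on_derive _ smoothL) Ot.
have dv := derivableP (diff_derivable (v := ((0, 1) : R * R)) dc).
by have [] := (is_derive_slice2 _ _ _ _).1 dv.
Qed.

End phase.

Lemma smooth_family_is_derive (R : realType) (W : normedModType R) (I : set R)
    (f : R -> R -> W) (t : R) : smooth_family I f -> I t ->
  is_derive (0 : R) (1 : R) (fun e => f e t) (derive1 (fun e => f e t) 0).
Proof.
move=> [U [_ _ UI sf]] It; rewrite derive1E; apply/derivableP.
have d := smooth_on_is_derive ((1, 0) : R * R) sf (UI _ It).
by have [] := (is_derive_slice1 _ _ _ _).1 d.
Qed.

(** * Conservation of the Noether function *)

Theorem theorem6 (R : realType) (n : nat) (n_ge1 : (1 <= n)%N)
    (Omega : set (R * 'rV[R]_n * 'rV[R]_n))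
    (L : R -> 'rV[R]_n -> 'rV[R]_n -> R)
    (I : set R) (q : R -> 'rV[R]_n)
    (qe : R -> R -> 'rV[R]_n) (tau G : R -> R -> R) :
  smooth_Lagrangian Omega L ->
  open I -> is_interval I ->
  trajectory Omega I q ->
  space_change I q qe ->
  time_change I tau ->
  BH_function I G ->
  infinitesimal_BH_invariance L I qe tau G ->
  Lagrange_solution L I q ->
  forall s t : R, I s -> I t ->
    Noether_function L q qe tau G s = Noether_function L q qe tau G t.
Proof.
move=> [openO smoothL] openI itvI [_ qO] [[U [openU _ UI smoothQ]] qe0]
  [smooth_tau tau0] smoothG inv lag s t Is It.
wlog st : s t Is It / s <= t.
  by move=> H; case: (leP s t) => [|/ltW] st; [|apply/esym]; exact: H.
pose Q (p : R * R) := qe p.1 p.2.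
have sQ : smooth_on U Q := smoothQ.
pose l (p : R * R) := L p.2 (Q p) ('D_(0, 1) Q p).
pose m := variation_L L Q.
(* q and qe 0 only agree on I, but I is open: they have the same derivative. *)
have near_q (x : R) : I x -> \forall y \near x, qe 0 y = q y.
  move=> Ix; move: (open_nbhs_nbhs (conj openI Ix)).
  by apply: filterS => y /qe0.
have dqE (x : R) : I x -> derive1 q x = 'D_(0, 1) Q (0, x).
  move=> Ix; rewrite derive1E -derive_slice2; apply/esym.
  exact/near_eq_derive/near_q.
have phaseE (x : R) : I x -> phase Q (0, x) = (x, q x, derive1 q x).
  by move=> Ix; rewrite /phase dqE//= /Q/= qe0.
have phaseO (x : R) : I x -> Omega (phase Q (0, x)).
  by move=> Ix; rewrite phaseE//; exact: qO.
pose momentum x := grad_qdot L x (Q (0, x)) ('D_(0, 1) Q (0, x)).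
pose eta x := 'D_(1, 0) Q (0, x).
pose w x := dotp (momentum x) (eta x).
(* Product rule, Lagrange equation for the first factor, and exchange of mixed
   derivatives for the second. *)
have dw (x : R) : I x -> is_derive x 1 w (m (0, x)).
  move=> Ix; have Ux := UI _ Ix.
  have deta := is_derive_velocity_variation openU sQ Ux.
  have dmom : is_derive x 1 momentum
      (grad_q L x (Q (0, x)) ('D_(0, 1) Q (0, x))).
    have dm := derivable_momentum smoothL sQ Ux (phaseO _ Ix).
    (* The Lagrange equation gives the value of the derivative; that it exists
       comes from the smoothness of L. *)
    apply: DeriveDef; first exact: dm.
    rewrite /Q/= qe0// -/(Q _) -dqE//.
    move/eqP: (lag _ Ix); rewrite subr_eq0 derive1E => /eqP <-.
    apply: near_eq_derive; near=> y; rewrite /momentum.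
    have Iy : I y by near: y; exact: open_nbhs_nbhs.
    by rewrite -dqE// /Q/= qe0.
  exact: is_derive_dotp dmom deta.
have Q0 (x : R) : I x -> Q (0, x) = q x by exact: qe0.
have etaE (x : R) : derive1 (fun e => qe e x) 0 = eta x.
  by rewrite derive1E; exact: (derive_slice1 Q 0 x).
have velocityE (e x : R) : derive1 (qe e) x = 'D_(0, 1) Q (e, x).
  by rewrite derive1E; exact: (derive_slice2 Q e x).
have NE (x : R) : I x -> Noether_function L q qe tau G x =
    w x + l (0, x) * derive1 (fun e => tau e x) 0 + derive1 (fun e => G e x) 0.
  by move=> Ix; rewrite /Noether_function etaE dqE// -Q0.
have [r r0 rI] : exists2 r : R, 0 < r & `[s - r, t + r] `<=` I.
  have /nbhs_ballP[rs /= rs0 rsI] := open_nbhs_nbhs (conj openI Is).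
  have /nbhs_ballP[rt /= rt0 rtI] := open_nbhs_nbhs (conj openI It).
  exists (Num.min rs rt / 2); first by rewrite divr_gt0// lt_min rs0.
  have h0 : 0 < Num.min rs rt by rewrite lt_min rs0.
  have hs : Num.min rs rt <= rs by rewrite ge_min lexx.
  have ht : Num.min rs rt <= rt by rewrite ge_min lexx orbT.
  move=> x /=; rewrite in_itv/=; apply: itvI; [apply: rsI|apply: rtI].
  - by rewrite /ball/= ltr_norml; apply/andP; split; lra.
  - by rewrite /ball/= ltr_norml; apply/andP; split; lra.
have dl (x : R) : x \in `[s - r, t + r] -> \forall p \near ((0, x) : R * R),
    is_derive (p : R * R) (1, 0) l (m p) /\ {for p, continuous l}.
  move=> /rI Ix.
  have := near_domain openO openU sQ (UI _ Ix) (phaseO _ Ix).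
  apply: filterS => p [Up Op]; split.
    exact: (is_derive_Lphase smoothL sQ Up Op).
  apply: (@continuous_comp _ _ _ (phase Q)
    (fun z : R * 'rV[R]_n * 'rV[R]_n => L z.1.1 z.1.2 z.2)).
    exact/differentiable_continuous/(differentiable_phase sQ).
  exact: smooth_on_continuous smoothL Op.
have cm (x : R) : x \in `[s - r, t + r] -> {for ((0, x) : R * R), continuous m}.
  move=> /rI Ix.
  exact: (continuous_variation_L smoothL sQ (UI _ Ix) (phaseO _ Ix)).
have dwst (x : R) : x \in `[tau 0 s, tau 0 t] -> is_derive x 1 w (m (0, x)).
  rewrite !tau0// in_itv/= => xst; exact/dw/(itvI s t).
have dts := smooth_family_is_derive smooth_tau Is.
have dtt := smooth_family_is_derive smooth_tau It.
have dGs := smooth_family_is_derive smoothG Is.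
have dGt := smooth_family_is_derive smoothG It.
have tau_st : tau 0 s <= tau 0 t by rewrite !tau0.
have us : s - r < tau 0 s by rewrite tau0// ltrBlDr ltrDl.
have tv : tau 0 t < t + r by rewrite tau0// ltrDl.
have dA := is_derive_oriented_integral tau_st us tv dl cm dwst dts dtt.
have actionE :
    (fun e => action L (tau e s) (tau e t) (qe e) + G e t - G e s) =
    (fun e => oriented_integral (tau e s) (tau e t) (fun x => l (e, x))
      + G e t - G e s).
  apply/funext => e; rewrite /action.
  have -> : (fun x => L x (qe e x) (derive1 (qe e) x)) = fun x => l (e, x).
    by apply/funext => x; rewrite velocityE.
  by [].
have dT := is_deriveB (is_deriveD dA dGt) dGs.
have := inv s t Is It; rewrite actionE derive1E.
move=> /(etrans (esym (@derive_val _ _ _ _ _ _ _ dT))).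
by rewrite (tau0 _ Is) (tau0 _ It) (NE _ Is) (NE _ It); lra.
Unshelve. all: by end_near. Qed.
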